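(* There is an absolute constant $n_0$ such that for all integers $n \geq n_0$, $$ES(n) \leq 2^{\,n + 6n^{2/3}\log n},$$ where $\log$ denotes the logarithm to base $2$.
   Context: A set of points in the plane $\mathbb{R}^2$ is in general position if no three of its points lie on a line. A finite set of points in the plane in general position is in convex position if its points are the vertices of a convex polygon (equivalently, no point of the set lies in the convex hull of the other points). For an integer $n \geq 3$, $ES(n)$ denotes the smallest integer such that any set of $ES(n)$ points in the plane in general position contains $n$ points in convex position (this integer exists for every $n\ge 3$ by a classical theorem of Erdős and Szekeres). *)

(* Defs.v *)
From mathcomp Require Import all_boot all_order all_algebra finmap.
From mathcomp Require Import all_classical all_reals.
From mathcomp Require Import convex exp.

Set Implicit Arguments.
Unset Strict Implicit.
Unset Printing Implicit Defensive.

Import Order.TTheory GRing.Theory Num.Theory.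
Local Open Scope classical_set_scope.
Local Open Scope ring_scope.

Definition is_line (R : realType) (L : set 'rV[R]_2) : Prop :=
  exists a b c : R, (a, b) <> (0, 0) /\
    L = [set p | a * p ord0 ord0 + b * p ord0 ord_max = c].

Definition general_position (R : realType) (P : {fset 'rV[R]_2}) : Prop :=
  forall p q r : 'rV[R]_2, p \in P -> q \in P -> r \in P ->
    p <> q -> p <> r -> q <> r ->
    ~ exists L, [/\ is_line L, L p, L q & L r].

Definition convex_hull (R : realType) (A : set 'rV[R]_2) : set 'rV[R]_2 :=
  smallest (@convex_set R 'rV[R]_2) A.

(* The points of P are the vertices of a convex polygon exactly when none of
   them lies in the convex hull of the others. *)
Definition convex_position (R : realType) (P : {fset 'rV[R]_2}) : Prop :=
  general_position P /\
  forall p, p \in P -> ~ convex_hull [set` (P `\ p)%fset] p.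

Definition contains_convex (R : realType) (n : nat) (P : {fset 'rV[R]_2}) :
    Prop :=
  exists Q : {fset 'rV[R]_2},
    [/\ (Q `<=` P)%fset, #|` Q| = n & convex_position Q].

Definition forces_convex (R : realType) (n N : nat) : Prop :=
  forall P : {fset 'rV[R]_2},
    general_position P -> #|` P| = N -> contains_convex n P.

(* [is_ES R n N] says that ES(n) exists and equals N. *)
Definition is_ES (R : realType) (n N : nat) : Prop :=
  forces_convex R n N /\ forall M : nat, forces_convex R n M -> (N <= M)%N.

Definition log2 (R : realType) (x : R) : R := ln x / ln 2.

(* Main.v *)
(* Suk's argument, carried out with orientations of triples only.  Averaging the
   cups-caps theorem over all subsets of a suitable size (Por-Valtr) yields a
   convex polygon X_0, X_1, ... with many gaps, such that at least a fraction
   2^(-O(number of gaps)) of all the points can be inserted in each gap.  Within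
   the gap between X_i and X_(i+1), the angular orders around X_(i-1) and X_(i+2)
   are two linear orders, so the gap contains a large chain (the orders disagree)
   or a large antichain (they agree).  In an antichain, cups-caps gives either n
   points in convex position or a convex chain of u points, and such convex
   chains taken in s non-adjacent gaps concatenate to a polygon with s u >= n
   vertices.  In a run of s consecutive chains, a clique of one colour in a gap
   and a clique of the other colour in the next gap form a polygon; so, unless
   there is a convex n-gon, the clique of the first colour must grow by u at every
   step, to n after s steps.  Finally s is about n^(1/3), u about n^(2/3) and there
   are about s^2 gaps. *)
Require Import Defs.
From mathcomp Require Import all_boot all_order all_algebra finmap.
From mathcomp Require Import all_classical all_reals.
From mathcomp Require Import convex exp.
From mathcomp Require Import zify ring lra.

(* [all_classical] shadows the finite set library. *)
Import fintype boot.finset.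

Set Implicit Arguments.
Unset Strict Implicit.
Unset Printing Implicit Defensive.

(** * Cups and caps *)

Section Triwise.
Variables (T : eqType) (c : T -> T -> T -> bool).

(* For [c] the counterclockwise orientation: [s] lists the vertices of a convex
   polygon in counterclockwise order. *)
Fixpoint triwise (s : seq T) : bool :=
  if s is x :: s' then pairwise (c x) s' && triwise s' else true.

(** The four conjuncts sort the triples by the number of members taken from [s1]: three, none, one,
    two. *)
Lemma triwise_cat s1 s2 :
  triwise (s1 ++ s2) =
  [&& triwise s1, triwise s2, all (fun x => pairwise (c x) s2) s1
    & all (fun z => pairwise (fun x y => c x y z) s1) s2].
Proof.
elim: s1 => [|x s1 IH] /=.
  by rewrite (_ : all _ s2) ?andbT //; apply/allP.
rewrite IH pairwise_cat.
have -> : all (fun z => all (fun y => c x y z) s1 &&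
                        pairwise (fun x y => c x y z) s1) s2 =
  allrel (c x) s1 s2 && all (fun z => pairwise (fun x y => c x y z) s1) s2.
  by rewrite all_predI allrelC.
case: (allrel _ _ _); case: (pairwise (c x) s1); case: (pairwise (c x) s2);
  case: (triwise s1); case: (triwise s2) => //=;
  by rewrite ?andbF ?andbT.
Qed.

Lemma triwise_rcons s z :
  triwise (rcons s z) = triwise s && pairwise (fun x y => c x y z) s.
Proof.
rewrite -cats1 triwise_cat /= andbT; congr andb.
by rewrite (_ : all _ _ = true) //=; apply/allP.
Qed.

Lemma triwise_subseq s1 s2 : subseq s1 s2 -> triwise s2 -> triwise s1.
Proof.
elim: s2 s1 => [|y s2 IH] [|x s1] //=.
case: eqVneq => [-> sub /andP[p t]|_ sub /andP[_ t]].
  by rewrite (IH _ sub t) (subseq_pairwise sub p).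
exact: IH sub t.
Qed.

Lemma triwiseP x0 s :
  reflect (forall i j k, i < j -> j < k -> k < size s ->
             c (nth x0 s i) (nth x0 s j) (nth x0 s k))
          (triwise s).
Proof.
elim: s => [|x s IH] /=; first by apply: ReflectT.
apply: (iffP andP) => [[/(pairwiseP x0) p /IH t] [|i] [|j] [|k] //= ij jk ks|h].
- by apply: p => //; rewrite inE; lia.
- exact: t.
split; last by apply/IH => i j k ij jk ks; exact: (h i.+1 j.+1 k.+1).
by apply/(pairwiseP x0) => j k; rewrite !inE => js ks jk; exact: (h 0 j.+1 k.+1).
Qed.

End Triwise.

Lemma pairwise_rev (T : Type) (r : rel T) s :
  pairwise r (rev s) = pairwise (fun x y => r y x) s.
Proof.
by elim: s => [//|x s IH]; rewrite rev_cons pairwise_rcons IH all_rev.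
Qed.

Lemma triwise_rev (T : eqType) (c : T -> T -> T -> bool) s :
  triwise c (rev s) = triwise (fun x y z => c z y x) s.
Proof.
elim: s => [//|x s IH]; rewrite rev_cons triwise_rcons IH /= andbC; congr andb.
by rewrite pairwise_rev.
Qed.

Lemma eq_triwise (T : eqType) (c d : T -> T -> T -> bool) :
  (forall x y z, c x y z = d x y z) -> triwise c =1 triwise d.
Proof.
move=> e; elim=> [//|x s IH] /=; rewrite IH; congr andb.
exact: (eq_pairwise (e x) s).
Qed.

Lemma triwise_uniq (T : eqType) (c : T -> T -> T -> bool) s :
  (forall x y z, c x y z -> [&& x != y, y != z & x != z]) ->
  2 < size s -> triwise c s -> uniq s.
Proof.
move=> cN; case: s => [//|x t] /= st /andP[p _].
have /(pairwiseP x) pt := p.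
apply/andP; split; last first.
  rewrite uniq_pairwise; apply: sub_pairwise p => u v.
  by case/cN/and3P.
apply/(nthP x) => -[i it ix].
case: (posnP i) => [i0|i_gt0].
  have : c x (nth x t 0) (nth x t 1) by apply: pt; rewrite // inE; lia.
  by case/cN/and3P; rewrite -{1}ix i0 eqxx.
have : c x (nth x t 0) (nth x t i) by apply: pt; rewrite // inE; lia.
by case/cN/and3P=> _ _; rewrite ix eqxx.
Qed.

Section CupsCaps.
Variables (T : finType) (lt : rel T) (c d : T -> T -> T -> bool) (U : {set T}).
Hypothesis lt_tot :
  forall x y, x \in U -> y \in U -> x != y -> lt x y || lt y x.
Hypothesis lt_trans : forall y x z, x \in U -> y \in U -> z \in U ->
  lt x y -> lt y z -> lt x z.
Hypothesis cd_tot : forall x y z, x \in U -> y \in U -> z \in U ->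
  lt x y -> lt y z -> c x y z || d x y z.
Hypothesis c_trans : forall w x y z,
  w \in U -> x \in U -> y \in U -> z \in U ->
  lt w x -> lt x y -> lt y z -> c w x y -> c x y z -> c w x z && c w y z.
Hypothesis d_trans : forall w x y z,
  w \in U -> x \in U -> y \in U -> z \in U ->
  lt w x -> lt x y -> lt y z -> d w x y -> d x y z -> d w x z && d w y z.

(** A [c]-clique plays the part of a cup, a [d]-clique that of a cap. [lt] is an order on [U] only,
    because an angular order around a point is linear only on suitable sets. *)
Definition clique (e : T -> T -> T -> bool) (V : {set T}) (W : seq T) :=
  [&& all (mem V) W, pairwise lt W & triwise e W].

Lemma cliqueS e (V V' : {set T}) W :
  V \subset V' -> clique e V W -> clique e V' W.
Proof.
move=> /subsetP sV /and3P[a p t]; apply/and3P; split=> //.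
by apply: sub_all a => x; exact: sV.
Qed.

Lemma clique_subseq e V W W' : subseq W' W -> clique e V W -> clique e V W'.
Proof.
move=> s /and3P[a p t]; apply/and3P; split.
- by apply/allP => x /(mem_subseq s); apply/allP.
- exact: subseq_pairwise s p.
- exact: triwise_subseq s t.
Qed.

Lemma clique_pair e (V : {set T}) : V \subset U -> 1 < #|V| ->
  exists2 W, clique e V W & size W = 2.
Proof.
move=> /subsetP sV /card_gt1P[x [y [xV yV xy]]].
case/orP: (lt_tot (sV _ xV) (sV _ yV) xy) => l.
- by exists [:: x; y]; rewrite // /clique /= xV yV l.
- by exists [:: y; x]; rewrite // /clique /= xV yV l.
Qed.

(** [d_trans] acts twice: through [y] it gives every [d w x z], and these together with [d x z z']
    give every [d w z z']. *)
Lemma clique_cons (V : {set T}) w x y W : V \subset U -> w \in V -> lt w x ->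
  d w x y -> clique d V [:: x, y & W] -> clique d V [:: w, x, y & W].
Proof.
move=> /subsetP sV wV wx dw K; set Z := y :: W in K *.
have [xV aZ] : x \in V /\ all (mem V) Z by case/and3P: K => /andP[].
have [xZ pZ] : all (lt x) Z /\ pairwise lt Z by case/and3P: K => _ /andP[].
have [dx tZ] : pairwise (d x) Z /\ triwise d Z.
  by case/and3P: K => _ _ /andP[].
have U1 z : z \in V -> z \in U by exact: sV.
have ZU z : z \in Z -> z \in U by move=> zZ; apply: U1; exact: (allP aZ).
have wZ z : z \in Z -> lt w z.
  move=> zZ; exact: lt_trans (U1 _ wV) (U1 _ xV) (ZU _ zZ) wx
                             (allP xZ _ zZ).
have dwx z : z \in Z -> d w x z.
  rewrite inE => /predU1P[-> //|zW].
  have yZ : y \in Z by exact: mem_head.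
  have zZ : z \in Z by rewrite inE zW orbT.
  have xy := allP xZ _ yZ.
  have /andP[yW _] : pairwise lt (y :: W) := pZ.
  have /andP[dxW _] : pairwise (d x) (y :: W) := dx.
  have := d_trans (U1 _ wV) (U1 _ xV) (ZU _ yZ) (ZU _ zZ)
                  wx xy (allP yW _ zW) dw (allP dxW _ zW).
  by case/andP.
apply/and3P; split.
- change [&& w \in V, x \in V & all (mem V) Z].
  by rewrite wV xV aZ.
- change [&& lt w x && all (lt w) Z, all (lt x) Z & pairwise lt Z].
  by rewrite wx xZ pZ !andbT; apply/allP.
- change [&& all (d w x) Z && pairwise (d w) Z, pairwise (d x) Z & triwise d Z].
  rewrite dx tZ !andbT; apply/andP; split; first exact/allP.
  have pp : pairwise [rel z z' | lt z z' && d x z z'] Z.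
    by rewrite pairwise_relI pZ dx.
  apply: (@sub_in_pairwise _ (mem Z) [rel z z' | lt z z' && d x z z']) pp.
    move=> z z' /= zZ z'Z /andP[zz' dxz].
    have := d_trans (U1 _ wV) (U1 _ xV) (ZU _ zZ)
      (ZU _ z'Z) wx (allP xZ _ zZ) zz' (dwx _ zZ) dxz.
    by case/andP.
  exact/allP.
Qed.

Lemma clique_rcons (V : {set T}) W x y z : V \subset U -> z \in V -> lt y z ->
  c x y z -> clique c V (rcons (rcons W x) y) ->
  clique c V (rcons (rcons (rcons W x) y) z).
Proof.
move=> /subsetP sV zV yz cz K; set Z := rcons W x in K *.
have /and3P[] := K.
rewrite all_rcons pairwise_rcons triwise_rcons.
move=> /andP[yV aZ] /andP[Zy pZ] /andP[tZ cy].
have U1 t : t \in V -> t \in U by exact: sV.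
have xZ : x \in Z by rewrite mem_rcons mem_head.
have xy : lt x y by exact: (allP Zy).
have {}yV : y \in V := yV.
have ZU t : t \in Z -> t \in U by move=> zZ; apply: U1; exact: (allP aZ).
have Zz t : t \in Z -> lt t z.
  move=> tZ'; exact: lt_trans (ZU _ tZ') (U1 _ yV) (U1 _ zV)
                              (allP Zy _ tZ') yz.
have czt t : t \in Z -> c t y z.
  rewrite mem_rcons inE => /predU1P[-> //|tW].
  have tZ' : t \in Z by rewrite mem_rcons inE tW orbT.
  have tx : lt t x by move: pZ; rewrite pairwise_rcons => /andP[/allP-> ].
  have ct : c t x y by move: cy; rewrite pairwise_rcons => /andP[/allP-> ].
  have := c_trans (ZU _ tZ') (ZU _ xZ) (U1 _ yV)
                  (U1 _ zV) tx xy yz ct cz.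
  by case/andP.
apply/and3P; split.
- by rewrite 2!all_rcons aZ /= zV yV.
- by rewrite 2!pairwise_rcons all_rcons yz pZ Zy !andbT; apply/allP.
- rewrite 2!triwise_rcons tZ cy pairwise_rcons /=; apply/andP; split.
    exact/allP.
  have pp : pairwise [rel t t' | lt t t' && c t t' y] Z.
    by rewrite pairwise_relI pZ cy.
  apply: (@sub_in_pairwise _ (mem Z) [rel t t' | lt t t' && c t t' y]) pp.
    move=> t t' /= tZ' t'Z /andP[tt' ct].
    have := c_trans (ZU _ tZ') (ZU _ t'Z) (U1 _ yV)
      (U1 _ zV) tt' (allP Zy _ t'Z) yz ct (czt _ t'Z).
    by case/andP.
  exact/allP.
Qed.

Lemma cups_caps_aux k l (V : {set T}) : V \subset U -> 'C(k + l, k) < #|V| ->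
  (exists2 W, clique c V W & size W = k.+2) \/
  (exists2 W, clique d V W & size W = l.+2).
Proof.
elim: k l V => [|k IHk] l V sV.
  by rewrite bin0 => V1; left; exact: clique_pair.
elim: l V sV => [|l IHl] V sV.
  by rewrite addn0 binn => V1; right; exact: clique_pair.
rewrite addnS addSn binS -addSn => Vgt.
(* [S] collects the last vertices of the [c]-cliques of size [k.+2]: such a clique
   and a [d]-clique starting at its last vertex can be merged by one vertex. *)
pose S := [set x in V | `[< exists K y,
             clique c V (rcons (rcons K y) x) /\ size K = k >]].
have SV : S \subset V by apply/subsetP => x; rewrite inE => /andP[].
have DV : V :\: S \subset V by exact: subsetDl.
have cVS : #|V| = #|S| + #|V :\: S|.
  by rewrite -(cardsID S V) (setIidPr SV).
have [VS|VS] := ltnP 'C(k + l.+1, k) #|V :\: S|.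
  have [[W KW sW]|[W KW sW]] := IHk _ _ (subset_trans DV sV) VS; last first.
    by right; exists W => //; apply: cliqueS KW.
  (* A [c]-clique of size [k.+2] outside [S] would put its own last vertex into [S]. *)
  exfalso; move: KW sW; case/lastP: W => [//|W x]; case/lastP: W => [//|W y] KW.
  rewrite !size_rcons => -[sW].
  have /and3P[] := KW; rewrite all_rcons /= inE => /andP[/andP[xS xV] _] _ _.
  case/negP: xS; rewrite inE xV; apply/asboolP; exists W, y; split=> //.
  exact: cliqueS KW.
have Sgt : 'C(k.+1 + l, k.+1) < #|S|.
  by move: VS; rewrite addnS addSn; lia.
have [[W KW sW]|[W KW sW]] := IHl _ (subset_trans SV sV) Sgt.
  by left; exists W => //; apply: cliqueS KW.
case: W KW sW => [//|x [//|y W]] KW [sW].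
have /and3P[/= /andP[xS _] /andP[/andP[xy _] _] _] := KW.
have KWV : clique d V [:: x, y & W] := cliqueS SV KW.
have /and3P[/= /and3P[xV yV _] _ _] := KWV.
move: xS; rewrite inE xV => /asboolP[K [w [KK sK]]].
have /and3P[] := KK; rewrite !all_rcons !pairwise_rcons !all_rcons.
move=> /and3P[_ wV _] /andP[/andP[wx _] _] _.
have U1 t : t \in V -> t \in U by exact: (subsetP sV).
case/orP: (cd_tot (U1 _ wV) (U1 _ xV) (U1 _ yV) wx xy) => e.
  left; exists (rcons (rcons (rcons K w) x) y); last by rewrite !size_rcons sK.
  exact: clique_rcons.
right; exists [:: w, x, y & W]; last by rewrite /= sW.
exact: clique_cons.
Qed.

(** Two vertices are given up in each clique, so that the sizes match the binomial coefficient
    without a shift. *)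
Lemma cups_caps k l (V : {set T}) : V \subset U -> 'C(k + l, k) < #|V| ->
  (exists2 W, clique c V W & size W = k) \/
  (exists2 W, clique d V W & size W = l).
Proof.
move=> sV /(cups_caps_aux sV)[[W K sW]|[W K sW]]; [left|right].
- exists (take k W); first exact: clique_subseq (take_subseq _ _) K.
  by rewrite size_takel // sW; lia.
- exists (take l W); first exact: clique_subseq (take_subseq _ _) K.
  by rewrite size_takel // sW; lia.
Qed.

End CupsCaps.

(** * Two linear orders on a finite set *)

Lemma exists_minimal (T : finType) (lt : rel T) (V : {set T}) :
  (forall x, ~~ lt x x) ->
  (forall y x z, x \in V -> y \in V -> z \in V -> lt x y -> lt y z -> lt x z) ->
  V != set0 -> exists2 x, x \in V & forall y, y \in V -> ~~ lt y x.
Proof.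
move=> irr tr /set0Pn[x0 x0V].
(* Take the fewest predecessors: a predecessor of [x] would have fewer still. *)
case: (arg_minnP (fun x => #|[set y in V | lt y x]|) x0V) => x xV xmin.
exists x => // y yV; apply/negP => yx.
have := xmin y yV; rewrite leqNgt => /negP[]; apply: proper_card.
apply/properP; split.
  by apply/subsetP => z; rewrite !inE => /andP[zV zy]; rewrite zV (tr y).
by exists y; rewrite !inE ?yV ?yx // (negPf (irr y)).
Qed.

(** The Erdős-Szekeres theorem on monotone subsequences. Induction on [s] peels off the set [A] of
    minimal elements for the intersection of the two orders; on [A] the orders disagree. *)
Lemma monotone_subset (T : finType) (lt1 lt2 : rel T) (V : {set T}) s t :
  (forall x, ~~ lt1 x x) ->
  (forall x y, x \in V -> y \in V -> x != y -> lt1 x y || lt1 y x) ->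
  (forall x y, x \in V -> y \in V -> x != y -> lt2 x y || lt2 y x) ->
  (forall y x z, x \in V -> y \in V -> z \in V ->
     lt1 x y -> lt1 y z -> lt1 x z) ->
  (forall y x z, x \in V -> y \in V -> z \in V ->
     lt2 x y -> lt2 y z -> lt2 x z) ->
  s * t < #|V| ->
  (exists W : {set T}, [/\ W \subset V, s < #|W| &
     forall x y, x \in W -> y \in W -> lt1 x y -> lt2 x y]) \/
  (exists W : {set T}, [/\ W \subset V, t < #|W| &
     forall x y, x \in W -> y \in W -> lt1 x y -> lt2 y x]).
Proof.
move=> irr1; elim: s V => [|s IH] V tot1 tot2 tr1 tr2 Vgt.
  left; case/card_gt0P: Vgt => x xV.
  exists [set x]; rewrite cards1 sub1set; split=> // y z.
  by move=> /set1P-> /set1P->; rewrite (negPf (irr1 x)).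
pose A := [set x in V | [forall y in V, ~~ (lt1 y x && lt2 y x)]].
have AV : A \subset V by apply/subsetP => x; rewrite inE => /andP[].
have [tA|At] := ltnP t #|A|.
  right; exists A; split=> // x y xA yA xy.
  have [xV yV] := (subsetP AV _ xA, subsetP AV _ yA).
  have nxy : x != y by apply: contraTneq xy => ->.
  move: yA; rewrite inE => /andP[_ /forall_inP/(_ x xV)]; rewrite xy /= => n.
  by have := tot2 x y xV yV nxy; rewrite (negPf n).
have DV : V :\: A \subset V by exact: subsetDl.
have cVA : #|V| = #|A| + #|V :\: A| by rewrite -(cardsID A V) (setIidPr AV).
have D z : z \in V :\: A -> z \in V by exact: (subsetP DV).
have Dgt : s * t < #|V :\: A| by move: Vgt; rewrite mulSn; lia.
have [[W [sW cW W12]]|[W [sW cW W12]]] := IH (V :\: A)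
  (fun x y xV yV => tot1 x y (D x xV) (D y yV))
  (fun x y xV yV => tot2 x y (D x xV) (D y yV))
  (fun y x z xV yV zV => tr1 y x z (D x xV) (D y yV) (D z zV))
  (fun y x z xV yV zV => tr2 y x z (D x xV) (D y yV) (D z zV)) Dgt.
- have WV z : z \in W -> z \in V by move=> /(subsetP sW)/D.
  have W0 : W != set0 by rewrite -card_gt0; lia.
  (* The first element of [W] was not peeled off, so some [y] precedes it in both orders and can be
     put in front of [W]. *)
  have [x xW xmin] := exists_minimal irr1
    (fun y x z xW yW zW => tr1 y x z (WV x xW) (WV y yW) (WV z zW)) W0.
  have := subsetP sW _ xW; rewrite !inE => /andP[]; rewrite WV //=.
  move=> /forall_inPn[y yV]; rewrite negbK => /andP[yx1 yx2] _.
  have yW : y \notin W by apply: contraTN yx1 => /xmin.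
  left; exists (y |: W); split.
  + by rewrite subUset sub1set yV (subset_trans sW DV).
  + by rewrite cardsU1 yW.
  have lexz z : z \in W -> z = x \/ lt1 x z.
    move=> zW; have [->|zx] := eqVneq z x; first by left.
    right; have := tot1 _ _ (WV _ zW) (WV _ xW) zx.
    by rewrite (negPf (xmin _ zW)).
  have y1z z : z \in W -> lt1 y z.
    move=> zW; case: (lexz z zW) => [-> //|xz].
    exact: (tr1 x) (WV _ xW) (WV _ zW) yx1 xz.
  move=> u v; rewrite !inE => /predU1P[->|uW] /predU1P[->|vW].
  + by rewrite (negPf (irr1 y)).
  + move=> _; case: (lexz v vW) => [-> //|xv].
    by apply: (tr2 x) (WV _ xW) (WV _ vW) yx2 _ => //; exact: W12.
  + move=> uy; have := tr1 _ _ _ (WV _ uW) yV (WV _ uW) uy (y1z _ uW).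
    by rewrite (negPf (irr1 u)).
  + exact: W12.
- by right; exists W; split=> //; exact: subset_trans sW DV.
Qed.

(** * Polygons and their gaps *)

Lemma bin_leq_2exp n k : 'C(n, k) <= 2 ^ n.
Proof.
elim: n k => [|n IH] [|k] //=; rewrite ?bin0 ?expn_gt0 // binS expnS mul2n -addnn.
exact: leq_add.
Qed.

(** Much better than [2 ^ n] for small [k]; it keeps the antichains needed for a convex chain of [u]
    points small. *)
Lemma bin_leq_exp n k : 'C(n, k) <= n ^ k.
Proof.
elim: k => [|k IH]; first by rewrite bin0.
have [nk|kn] := ltnP n k.+1; first by rewrite bin_small.
rewrite expnS; apply: leq_trans (leq_mul (leqnn n) IH).
have := mul_bin_left n k.
have : n - k <= n by exact: leq_subr.
nia.
Qed.

(* Knuth's CC systems, with the five-point axiom in all its Horn forms: around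
   [t], no point can precede, nor follow, all points of a cyclic triangle. *)
Record orientation (T : finType) (ccw : T -> T -> T -> bool) : Prop :=
  Orientation {
    ccw_cyc : forall p q r, ccw p q r -> ccw q r p;
    ccw_asym : forall p q r, ccw p q r -> ~~ ccw p r q;
    ccw_tot : forall p q r, [&& p != q, q != r & p != r] ->
      ccw p q r || ccw p r q;
    ccw_interior : forall p q r t, ccw t q r -> ccw p t r -> ccw p q t ->
      ccw p q r;
    ccw_source : forall t s p q r,
      ccw t s p -> ccw t s q -> ccw t s r -> ccw t p q -> ccw t q r ->
      ccw t p r;
    ccw_sink : forall t s p q r,
      ccw t p s -> ccw t q s -> ccw t r s -> ccw t p q -> ccw t q r ->
      ccw t p r;
    ccw_in_cycle : forall t s p q r,
      ccw t s p -> ccw t s r -> ccw t p q -> ccw t q r -> ccw t r p ->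
      ccw t q s;
    ccw_out_cycle : forall t s p q r,
      ccw t p s -> ccw t r s -> ccw t p q -> ccw t q r -> ccw t r p ->
      ccw t s q;
    ccw_extreme : forall A : {set T}, A != set0 -> exists2 a, a \in A &
      forall p q r, p \in A -> q \in A -> r \in A -> p != r ->
      ccw a p q -> ccw a q r -> ccw a p r
  }.

Section Polygons.
Variables (T : finType) (ccw : T -> T -> T -> bool).
Hypothesis cc : orientation ccw.

Definition cw p q r := ccw p r q.

Lemma ccw_rot p q r : ccw p q r = ccw q r p.
Proof.
have cyc := ccw_cyc cc.
by apply/idP/idP => [/cyc //|/cyc/cyc].
Qed.

Lemma ccwaa p q : ccw p q q = false.
Proof. by apply/negP => h; have := ccw_asym cc h; rewrite h. Qed.

Lemma ccw_neq p q r : ccw p q r -> [&& p != q, q != r & p != r].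
Proof.
move=> h; apply/and3P; split; apply: contraTneq h.
- by move=> ->; rewrite -ccw_rot ccwaa.
- by move=> ->; rewrite ccwaa.
- by move=> ->; rewrite ccw_rot ccwaa.
Qed.

Lemma triwise_cw_rev W : triwise cw W -> triwise ccw (rev W).
Proof.
rewrite triwise_rev; set d := fun x y z => _.
by rewrite (@eq_triwise _ cw d) // => x y z; rewrite /cw /d ccw_rot ccw_rot.
Qed.

Definition convex_polygon n := exists2 W : seq T, triwise ccw W & size W = n.

Ltac ccr := solve [assumption | rewrite ccw_rot; assumption
                  | rewrite -ccw_rot; assumption].

(* The colouring of triples by orientation is transitive for the angular order
   around a point, as long as that order is linear. *)
Lemma cups_caps_around a (V : {set T}) k l :
  (forall p q r, p \in V -> q \in V -> r \in V ->
     ccw a p q -> ccw a q r -> ccw a p r) ->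
  a \notin V -> 'C(k + l, k) < #|V| ->
  (exists2 W, clique (ccw a) ccw V W & size W = k) \/
  (exists2 W, clique (ccw a) cw V W & size W = l).
Proof.
move=> tr aV; apply: (@cups_caps _ _ ccw cw V) => //.
- move=> x y xV yV xy; apply: (ccw_tot cc); rewrite xy.
  by apply/andP; split; apply: contraNneq aV => ->.
- by move=> y x z xV yV zV; exact: tr.
- move=> x y z xV yV zV axy ayz; apply: (ccw_tot cc).
  have /and3P[_ -> _] := ccw_neq axy; have /and3P[_ -> _] := ccw_neq ayz.
  by have /and3P[_ -> _] := ccw_neq (tr _ _ _ xV yV zV axy ayz).
- move=> w x y z wV xV yV zV wx xy yz cwxy cxyz.
  have wy := tr _ _ _ wV xV yV wx xy; have xz := tr _ _ _ xV yV zV xy yz.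
  have h1 : ccw x z w by apply: (@ccw_source _ _ cc x y z a w); ccr.
  have h2 : ccw y z w by apply: (@ccw_sink _ _ cc y x z a w); ccr.
  by apply/andP; split; ccr.
(* For clockwise triples, [a], [w], [y] are cyclic around [x], and [x], [z], [a] around [y]; hence
   the two cyclic axioms. *)
- rewrite /cw => w x y z wV xV yV zV wx xy yz cwxy cxyz.
  have wy := tr _ _ _ wV xV yV wx xy; have xz := tr _ _ _ xV yV zV xy yz.
  have h1 : ccw x w z by apply: (@ccw_in_cycle _ _ cc x z a w y); ccr.
  have h2 : ccw y w z by apply: (@ccw_out_cycle _ _ cc y w x z a); ccr.
  by apply/andP; split; ccr.
Qed.

(* [P i] consists of points that can be inserted between [X i] and [X i.+1] in
   the convex polygon [X 0, ..., X g.-1]. *)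
Record gapped g (X : nat -> T) (P : nat -> {set T}) : Prop := Gapped {
  gap_none : forall i j k, i < j -> j < k -> k < g -> ccw (X i) (X j) (X k);
  gap_last : forall i j k p, p \in P i -> j < k -> k <= i -> i < g ->
    ccw (X j) (X k) p;
  gap_mid : forall i j k p, p \in P i -> j <= i -> i < k -> k < g ->
    ccw (X j) p (X k);
  gap_first : forall i j k p, p \in P i -> i < j -> j < k -> k < g ->
    ccw p (X j) (X k)
}.

Section Gapped.
Variables (g : nat) (X : nat -> T) (P : nat -> {set T}).
Hypothesis gP : gapped g X P.

Ltac index_lia :=
  repeat match goal with
  | H : is_true (ccw _ _ _) |- _ => clear H
  | H : is_true (_ \in _) |- _ => clear H
  end; lia.

Ltac gap := solve
  [ apply: (gap_none gP); index_lia
  | apply: (gap_last gP); first eassumption; index_lia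
  | apply: (gap_mid gP); first eassumption; index_lia
  | apply: (gap_first gP); first eassumption; index_lia ].

Lemma gap_ccw i j l p q r : i < j -> j < l -> l < g ->
  p \in P i -> q \in P j -> r \in P l -> ccw p q r.
Proof.
move=> ij jl lg pP qP rP.
have h0 : ccw (X i) p (X j) by gap.
have h1 : ccw (X i) p (X l) by gap.
have h2 : ccw (X i) (X j) (X l) by gap.
have h3 : ccw p (X j) (X l) by gap.
have h4 : ccw (X i) (X j) q by gap.
have h5 : ccw (X i) q (X l) by gap.
have h6 : ccw (X j) q (X l) by gap.
have h7 : ccw (X i) (X j) r by gap.
have h8 : ccw (X i) (X l) r by gap.
have h9 : ccw (X j) (X l) r by gap.
have h10 : ccw (X i) p q by apply: (@ccw_sink _ _ cc (X i) (X l) p (X j) q); ccr.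
have h11 : ccw (X i) q r.
  by apply: (@ccw_source _ _ cc (X i) (X j) q (X l) r); ccr.
have h13 : ccw (X l) p q.
  by apply: (@ccw_source _ _ cc (X l) (X i) p (X j) q); ccr.
have h14 : ccw (X l) r p by apply: (@ccw_sink _ _ cc (X l) (X j) r (X i) p); ccr.
have pqr : [&& p != q, q != r & p != r].
  have /and3P[_ -> _] := ccw_neq h10; have /and3P[_ -> _] := ccw_neq h11.
  by have /and3P[_ ne _] := ccw_neq h14; rewrite eq_sym.
(* Around [p] the vertex [X l] comes between [q] and [r]; it remains to see that [r] precedes [X i].
   The opposite orientation gives this, as [q] would lie inside the triangle [p], [r], [X i]. *)
case/orP: (ccw_tot cc pqr) => // prq.
have h12 : ccw p r (X i) by apply: (@ccw_interior _ _ cc p r (X i) q); ccr.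
by apply: (@ccw_sink _ _ cc p (X i) q (X l) r); ccr.
Qed.

(* For p, q in the gap i the line pq either crosses the segment from [X i.-1]
   to [X i.+2] (chains) or leaves both its endpoints on the same side
   (antichains). *)
Definition chain i (V : {set T}) := forall p q, p \in V -> q \in V ->
  ccw (X i.-1) p q -> ccw (X i.+2) q p.

Definition antichain i (V : {set T}) := forall p q, p \in V -> q \in V ->
  ccw (X i.-1) p q -> ccw (X i.+2) p q.

(** Seen from [q], the point [r] lies in the angle from [X i.+2] to [X i.-1], and both of these are
    to the left of the line from [p] to [q]; hence so is [r]. *)
Lemma antichain_before i l p q r : 0 < i -> i.+2 <= l -> l < g ->
  p \in P i -> q \in P i -> r \in P l ->
  ccw (X i.-1) p q -> ccw (X i.+2) p q -> ccw p q r.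
Proof.
move=> i_gt0 il lg pP qP rP h9 h10.
set a := X i.-1 in h9; set b := X i.+2 in h10; set x := X i; set y := X i.+1.
have h0 : ccw a x b by gap.
have h1 : ccw x y b by gap.
have h2 : ccw a x q by gap.
have h3 : ccw x q b by gap.
have h4 : ccw q y b by gap.
have h5 : ccw a x r by gap.
have h6 : ccw a b r by gap.
have h7 : ccw x b r by gap.
have h8 : ccw y b r by gap.
have h11 : ccw b r q by apply: (@ccw_sink _ _ cc b y r x q); ccr.
have h12 : ccw b a y by apply: (@ccw_source _ _ cc b r a x y); ccr.
have h13 : ccw b a q by apply: (@ccw_sink _ _ cc b y a x q); ccr.
have h14 : ccw x q r by apply: (@ccw_sink _ _ cc x a q b r); ccr.
have h15 : ccw r a q by apply: (@ccw_sink _ _ cc r b a x q); ccr.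
have : ccw q r p by apply: (@ccw_source _ _ cc q b r a p); ccr.
by move=> h16; ccr.
Qed.

(** The mirror image: seen from [r], the point [p] lies in the angle from [X l.+2] to [X l.-1]. *)
Lemma antichain_after i l p q r : i.+2 <= l -> l.+2 < g ->
  p \in P i -> q \in P l -> r \in P l ->
  ccw (X l.-1) q r -> ccw (X l.+2) q r -> ccw p q r.
Proof.
move=> il lg pP qP rP h9 h10.
set a := X l.-1 in h9; set b := X l.+2 in h10; set x := X l; set z := X i.
have h0 : ccw z p b by gap.
have h1 : ccw z x b by gap.
have h2 : ccw p a x by gap.
have h3 : ccw p a b by gap.
have h4 : ccw p x b by gap.
have h5 : ccw a x b by gap.
have h6 : ccw z r b by gap.
have h7 : ccw a x r by gap.
have h8 : ccw x r b by gap.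
have h11 : ccw b p r by apply: (@ccw_source _ _ cc b z p x r); ccr.
have h12 : ccw x r p by apply: (@ccw_sink _ _ cc x a r b p); ccr.
have h13 : ccw p a r by apply: (@ccw_sink _ _ cc p b a x r); ccr.
have h14 : ccw r b a by apply: (@ccw_sink _ _ cc r x b p a); ccr.
have : ccw r p q by apply: (@ccw_source _ _ cc r b p a q); ccr.
by move=> h16; ccr.
Qed.

(** Here [q] lies inside the triangle [X i.-1], [p], [X i.+2]. Two of its corners are to the left of
    the line from [q] to [r], so the third, [p], is to the right. *)
Lemma chain_before i p q r : 0 < i -> i.+2 < g ->
  p \in P i -> q \in P i -> r \in P i.+1 ->
  ccw (X i.-1) p q -> ccw (X i.+2) q p -> ccw q p r.
Proof.
move=> i_gt0 ig pP qP rP h7 h8.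
set a := X i.-1 in h7; set b := X i.+2 in h8; set y := X i.+1.
have h0 : ccw a y b by gap.
have h1 : ccw a q y by gap.
have h2 : ccw a q b by gap.
have h3 : ccw q y b by gap.
have h4 : ccw a y r by gap.
have h5 : ccw a r b by gap.
have h6 : ccw y r b by gap.
have h9 : ccw a q r by apply: (@ccw_sink _ _ cc a b q y r); ccr.
have h10 : ccw b q r by apply: (@ccw_source _ _ cc b a q y r); ccr.
by apply: (@ccw_in_cycle _ _ cc q r a p b); ccr.
Qed.

(** The mirror image: [r] lies inside the triangle [X i], [q], [X i.+3]. *)
Lemma chain_after i p q r : i.+3 < g ->
  p \in P i -> q \in P i.+1 -> r \in P i.+1 ->
  ccw (X i) q r -> ccw (X i.+3) r q -> ccw p q r.
Proof.
move=> ig pP qP rP h7 h8.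
set a := X i in h7; set b := X i.+3 in h8; set x := X i.+1.
have h0 : ccw a p x by gap.
have h1 : ccw a p b by gap.
have h2 : ccw a x b by gap.
have h3 : ccw p x b by gap.
have h4 : ccw a x r by gap.
have h5 : ccw a r b by gap.
have h6 : ccw x r b by gap.
have h9 : ccw a p r by apply: (@ccw_sink _ _ cc a b p x r); ccr.
have h10 : ccw b p r by apply: (@ccw_source _ _ cc b a p x r); ccr.
have : ccw r p q by apply: (@ccw_out_cycle _ _ cc r p a q b); ccr.
by move=> h16; ccr.
Qed.

(** Around [X i.-1] all points of the gap follow [X i], so they lie in a half-plane. *)
Lemma gap_trans i p q r : 0 < i -> i < g ->
  p \in P i -> q \in P i -> r \in P i ->
  ccw (X i.-1) p q -> ccw (X i.-1) q r -> ccw (X i.-1) p r.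
Proof.
move=> i_gt0 ig pP qP rP pq qr.
by apply: (@ccw_source _ _ cc _ (X i) _ q) => //; gap.
Qed.

Lemma gap_notin i : 0 < i -> i < g -> X i.-1 \notin P i.
Proof.
move=> i_gt0 ig; apply/negP => xP.
have : ccw (X i.-1) (X i) (X i.-1) by gap.
by rewrite ccw_rot ccwaa.
Qed.

Lemma gap_cups_caps i (V : {set T}) k l : 0 < i -> i < g -> V \subset P i ->
  'C(k + l, k) < #|V| ->
  (exists2 W, clique (ccw (X i.-1)) ccw V W & size W = k) \/
  (exists2 W, clique (ccw (X i.-1)) cw V W & size W = l).
Proof.
move=> i_gt0 ig /subsetP VP; apply: cups_caps_around.
  by move=> p q r /VP pP /VP qP /VP rP; exact: gap_trans.
by apply: contra (gap_notin i_gt0 ig) => /VP.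
Qed.

Lemma gap_dichotomy i s t : 0 < i -> i.+2 < g -> s * t < #|P i| ->
  (exists V : {set T}, [/\ V \subset P i, s < #|V| & chain i V]) \/
  (exists V : {set T}, [/\ V \subset P i, t < #|V| & antichain i V]).
Proof.
move=> i_gt0 ig st.
have ne p j : p \in P i -> i.+2 = j \/ j = i.-1 -> X j != p.
  move=> pP [<-|->].
    have : ccw (X i) p (X i.+2) by gap.
    by case/ccw_neq/and3P => _; rewrite eq_sym.
  have : ccw (X i.-1) p (X i.+1) by gap.
  by case/ccw_neq/and3P.
have tot p q j : p \in P i -> q \in P i -> i.+2 = j \/ j = i.-1 -> p != q ->
    ccw (X j) p q || ccw (X j) q p.
  by move=> pP qP e pq; apply: (ccw_tot cc); rewrite pq !ne.
have irr p : ~~ ccw (X i.-1) p p by rewrite ccwaa.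
have tr p q r : p \in P i -> q \in P i -> r \in P i ->
    ccw (X i.+2) q p -> ccw (X i.+2) r q -> ccw (X i.+2) r p.
  move=> pP qP rP qp rq.
  have bp u : u \in P i -> ccw (X i.+2) (X i.-1) u.
    move=> uP; have h : ccw (X i.-1) u (X i.+2) by gap.
    by ccr.
  by apply: (@ccw_source _ _ cc _ (X i.-1) _ q) => //; exact: bp.
(* The order around [X i.+2] is taken backwards, which turns monotone sets into chains. *)
apply: (@monotone_subset _ (ccw (X i.-1)) (fun p q => ccw (X i.+2) q p)
  (P i) s t irr _ _ _ _ st).
- by move=> p q pP qP; exact: tot pP qP (or_intror erefl).
- by move=> p q pP qP; rewrite orbC; exact: tot pP qP (or_introl erefl).
- by move=> q p r pP qP rP; apply: gap_trans => //; lia.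
- by move=> q p r pP qP rP; exact: tr.
Qed.

(** * Convex polygons from chains and from antichains *)

Lemma chain_polygon i s n u (V : nat -> {set T}) :
  0 < i -> 0 < s -> i + s + 1 < g -> n <= s * u ->
  (forall j, j < s -> [/\ V j \subset P (i + j), 2 ^ (n + u) < #|V j|
                        & chain (i + j) (V j)]) ->
  convex_polygon n.
Proof.
move=> i_gt0 s_gt0 ig nsu VC.
case: (pselect (convex_polygon n)) => // ncv.
have bin_lt k l j : k + l <= n + u -> j < s -> 'C(k + l, k) < #|V j|.
  move=> kl /VC[_ Vn _]; apply: leq_ltn_trans (bin_leq_2exp _ _) _.
  by apply: leq_ltn_trans Vn; rewrite leq_pexp2l.
have step j : j < s -> exists2 W,
    clique (ccw (X (i + j).-1)) cw (V j) W & size W = minn (j.+1 * u) n.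
  elim: j => [|j IH] js.
    have [VP _ _] := VC 0 js.
    have i0 : 0 < i + 0 by lia.
    have i0g : i + 0 < g by lia.
    have le : n + minn (1 * u) n <= n + u by lia.
    have [[W /and3P[_ _ WC] sW]|//] :=
      gap_cups_caps i0 i0g VP (bin_lt _ _ _ le js).
    by case: ncv; exists W.
  have [VP _ VCj] := VC j (ltnW js); have [VP1 _ VCj1] := VC j.+1 js.
  have [W1 /and3P[/allP W1V W1p W1cw] sW1] := IH (ltnW js).
  have i0 : 0 < i + j.+1 by lia.
  have i0g : i + j.+1 < g by lia.
  (* The counterclockwise clique only has to supply the vertices that [W1] lacks, so the two sizes
     add up to at most [n + u] at every step. *)
  have le : (n - minn (j.+1 * u) n) + minn (j.+2 * u) n <= n + u.
    by rewrite (mulSn j.+1); lia.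
  have [[W2 /and3P[/allP W2V W2p W2ccw] sW2]|//] :=
    gap_cups_caps i0 i0g VP1 (bin_lt _ _ _ le js).
  case: ncv; exists (rev W1 ++ W2); last by rewrite size_cat size_rev; lia.
  have W1P p : p \in W1 -> p \in P (i + j) by move=> /W1V; exact: (subsetP VP).
  have W2P p : p \in W2 -> p \in P (i + j).+1.
    by move=> /W2V; rewrite -addnS; exact: (subsetP VP1).
  rewrite triwise_cat triwise_cw_rev // W2ccw /=; apply/andP; split.
    apply/allP => p; rewrite mem_rev => pW1.
    apply: (@sub_in_pairwise _ (mem W2)) W2p; last exact/allP.
    move=> q r qW2 rW2; rewrite addnS /= => qr.
    have rq := VCj1 q r (W2V q qW2) (W2V r rW2).
    rewrite addnS /= in rq.
    by apply: (chain_after (i := i + j)); rewrite ?W1P ?W2P ?rq //; lia.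
  apply/allP => r rW2; rewrite pairwise_rev.
  apply: (@sub_in_pairwise _ (mem W1)) W1p; last exact/allP.
  move=> p q pW1 qW1 pq.
  have qp := VCj p q (W1V p pW1) (W1V q qW1) pq.
  by apply: (chain_before (i := i + j)); rewrite ?W1P ?W2P ?qp //; lia.
have [W /and3P[_ _ Wcw] sW] : exists2 W,
    clique (ccw (X (i + s.-1).-1)) cw (V s.-1) W & size W = minn (s.-1.+1 * u) n.
  by apply: step; rewrite prednK.
case: ncv; exists (rev W); first exact: triwise_cw_rev.
by rewrite size_rev sW prednK //; lia.
Qed.

(** The reasons why a pair is counterclockwise with every point of a gap [l >= B]: the first
    alternative feeds [antichain_before], the second [gap_ccw]. *)
Definition before B x y :=
  (exists i, [/\ 0 < i, i.+2 <= B & [/\ x \in P i, y \in P i,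
                 ccw (X i.-1) x y & ccw (X i.+2) x y]]) \/
  (exists i j, [/\ i < j, j.+2 <= B, x \in P i & y \in P j]).

Lemma before_leq B B' x y : B <= B' -> before B x y -> before B' x y.
Proof.
move=> BB [[i [i0 iB h]]|[i [j [ij jB xP yP]]]]; [left|right].
  by exists i; split=> //; exact: leq_trans BB.
by exists i, j; split=> //; exact: leq_trans BB.
Qed.

Lemma antichain_polygon s n u :
  n <= s * u -> s * s.+1 + 1 < g ->
  (forall j, j < s -> exists i (V : {set T}) W,
     [/\ j * s.+1 < i <= j * s.+1 + s, V \subset P i, antichain i V,
         clique (ccw (X i.-1)) ccw V W & size W = u]) ->
  exists2 W, triwise ccw W & n <= size W.
Proof.
move=> nsu sg AC.
suff claim m : m <= s -> exists W, [/\ triwise ccw W, size W = m * u,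
    pairwise (fun x y => `[< before (m * s.+1).+1 x y >]) W &
    forall x, x \in W -> exists i, i.+2 <= (m * s.+1).+1 /\ x \in P i].
  by have [W [W3 sW _ _]] := claim s (leqnn s); exists W; rewrite ?sW.
elim: m => [_|m IH ms]; first by exists [::]; split.
have [W [W3 sW Wb WP]] := IH (ltnW ms).
have [i [V [W' [iB VP VA /and3P[/allP W'V W'p W'3] sW']]]] := AC m ms.
have iB' : i.+2 <= (m.+1 * s.+1).+1 by rewrite mulSn; lia.
have ig : i.+2 < g.
  apply: leq_ltn_trans iB' _; apply: leq_ltn_trans sg.
  by rewrite -addn1 leq_add2r leq_mul2r ms orbT.
have W'P x : x \in W' -> x \in P i by move=> /W'V; exact: (subsetP VP).
exists (W ++ W'); split.
- rewrite triwise_cat W3 W'3 /=; apply/andP; split.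
    apply/allP => p /WP[k [kB pP]].
    apply: (@sub_in_pairwise _ (mem W')) W'p; last exact/allP.
    move=> q r qW rW qr.
    have qr' := VA q r (W'V q qW) (W'V r rW) qr.
    by apply: (antichain_after (i := k) (l := i)); rewrite ?W'P //; lia.
  apply/allP => r rW'.
  apply: sub_pairwise Wb => p q /asboolP.
  case=> [[k [k0 kB [pP qP pq pq']]]|[k [l [kl lB pP qP]]]].
    by apply: (antichain_before (i := k) (l := i)); rewrite ?W'P //; lia.
  by apply: (gap_ccw (i := k) (j := l) (l := i)); rewrite ?W'P //; lia.
- by rewrite size_cat sW sW' mulSn addnC.
- rewrite pairwise_cat; apply/and3P; split.
  + apply/allrelP => x y /WP[k [kB xP]] /W'P yP; apply/asboolP; right.
    by exists k, i; split=> //; lia.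
  + apply: sub_pairwise Wb => x y /asboolP h; apply/asboolP.
    by apply: before_leq h; rewrite mulSn; lia.
  + apply: (@sub_in_pairwise _ (mem W')) W'p; last exact/allP.
    move=> x y xW yW xy; apply/asboolP; left; exists i; split=> //; first lia.
    by split; rewrite ?W'P // (VA x y (W'V x xW) (W'V y yW)).
- move=> x; rewrite mem_cat => /orP[/WP[k [kB xP]]|/W'P xP].
    by exists k; split=> //; rewrite mulSn; lia.
  by exists i.
Qed.

Lemma gapped_polygon s n u :
  0 < s -> n <= s * u -> s * s.+1 + 1 < g ->
  (forall i, i < g -> 2 ^ (n + u) * (u + n) ^ u < #|P i|) ->
  exists2 W, triwise ccw W & n <= size W.
Proof.
move=> s_gt0 nsu sg Pbig.
(* A block without a convex chain of [u] points in an antichain has a large chain in each of its [s]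
   consecutive gaps, and [chain_polygon] applies to it. *)
have [[W W3 sW]|ncv] := pselect (convex_polygon n).
  by exists W; rewrite ?sW.
apply: (antichain_polygon nsu sg) => j js; apply: contrapT => noA.
have jB : j * s.+1 + s.+1 <= s * s.+1.
  by rewrite addnC -mulSn leq_mul2r js orbT.
apply: (ncv).
have allC k : exists V : {set T}, k < s -> [/\ V \subset P (j * s.+1 + 1 + k),
    2 ^ (n + u) < #|V| & chain (j * s.+1 + 1 + k) V].
  (* [choice] needs a set for every [k]; beyond the block any set will do. *)
  have [ks|_] := ltnP k s; last by exists set0.
  set i := j * s.+1 + 1 + k.
  have i_gt0 : 0 < i by rewrite /i; lia.
  have ig : i.+2 < g by rewrite /i; lia.
  have ig' : i < g by lia.
  have [[V VC]|[V [VP Vu VA]]] := gap_dichotomy i_gt0 ig (Pbig i ig').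
    by exists V.
  have [[W WK sW]|[W /and3P[_ _ W3] sW]] :=
    gap_cups_caps i_gt0 ig' VP (leq_ltn_trans (bin_leq_exp _ _) Vu).
    by case: noA; exists i, V, W; split=> //; rewrite /i; lia.
  case: ncv; exists (rev W); rewrite ?size_rev //; exact: triwise_cw_rev.
have [V VC] := choice allC.
by apply: (chain_polygon (i := j * s.+1 + 1) (s := s)) VC => //; lia.
Qed.

End Gapped.
End Polygons.

(** * The positive fraction theorem *)

(** A random [m]-subset of [N] points contains [j] given points with probability at most
    [(m / N) ^ j], since each factor [(m - i) / (N - i)] is at most [m / N]. *)
Lemma expn_bin_leq N m j : j <= m -> m <= N ->
  N ^ j * 'C(N - j, m - j) <= m ^ j * 'C(N, m).
Proof.
move=> jm mN; elim: j jm => [|j IH] jm; first by rewrite !subn0.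
have {}IH := IH (ltnW jm).
have Nj : 0 < N - j by lia.
rewrite -(leq_pmul2l Nj).
have E : (N - j) * 'C(N - j.+1, m - j.+1) = (m - j) * 'C(N - j, m - j).
  by rewrite !subnS mul_bin_diag prednK // subn_gt0.
rewrite mulnCA E !expnS.
have le : N * (m - j) <= m * (N - j) by nia.
move: le IH; move: (N ^ j) (m ^ j) 'C(N - j, m - j) 'C(N, m) => a b c d le IH.
have := leq_mul le IH; lia.
Qed.

Lemma card_supersets (T : finType) (S : {set T}) m :
  #|[set A : {set T} | S \subset A & #|A| == m]| <= 'C(#|T| - #|S|, m - #|S|).
Proof.
have -> : #|T| - #|S| = #|~: S| by rewrite -(cardsC S); lia.
rewrite -cards_draws -(card_in_imset (f := fun A => A :\: S)).
  apply: subset_leq_card; apply/subsetP => _ /imsetP[A + ->].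
  rewrite !inE => /andP[SA /eqP Am]; rewrite setDE subsetIr /=.
  by rewrite -setDE cardsD (setIidPr SA) Am.
move=> A B; rewrite !inE => /andP[SA _] /andP[SB _] e.
by rewrite -(setID A S) -(setID B S) (setIidPr SA) (setIidPr SB) e.
Qed.

Section PositiveFraction.
Variables (T : finType) (ccw : T -> T -> T -> bool).
Hypothesis cc : orientation ccw.

Lemma polygon_in (A : {set T}) k : (2 ^ (k + k)).+1 < #|A| ->
  exists W, [/\ {subset W <= A}, triwise ccw W & size W = k].
Proof.
move=> Ak; have A0 : A != set0 by rewrite -card_gt0; lia.
have [a aA tr] := ccw_extreme cc A0.
have le : 'C(k + k, k) < #|A :\ a|.
  apply: leq_ltn_trans (bin_leq_2exp _ _) _.
  by move: Ak; rewrite (cardsD1 a A) aA; lia.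
have DA x : x \in A :\ a -> x \in A by case/setD1P.
have tr' p q r : p \in A :\ a -> q \in A :\ a -> r \in A :\ a ->
    ccw a p q -> ccw a q r -> ccw a p r.
  move=> /DA pA /DA qA /DA rA pq qr; apply: (tr _ _ _ _ _ _ _ pq qr) => //.
  by apply: contraTneq pq => ->; exact: (ccw_asym cc).
have aDA : a \notin A :\ a by rewrite !inE eqxx.
case: (cups_caps_around cc tr' aDA le).
- case=> W /and3P[/allP WA _ W3] sW; exists W; split=> // x /WA; exact: DA.
- case=> W /and3P[/allP WA _ W3] sW; exists (rev W); split.
  + by move=> x; rewrite mem_rev => /WA; exact: DA.
  + exact: triwise_cw_rev.
  + by rewrite size_rev.
Qed.

Section Count.
Variable K : nat.
Implicit Types (x y : {ffun 'I_K -> T}).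

Definition polygonal x :=
  [forall i : 'I_K, forall j : 'I_K, forall k : 'I_K,
    (i < j < k) ==> ccw (x i) (x j) (x k)].

Definition gap_set x (i : 'I_K) : {set T} :=
  [set p | [forall j : 'I_K, forall k : 'I_K,
    [&& (j < k <= i) ==> ccw (x j) (x k) p, (j <= i < k) ==> ccw (x j) p (x k)
      & (i < j < k) ==> ccw p (x j) (x k)]]].

Definition vertices x y := [set x i | i : 'I_K] :|: [set y i | i : 'I_K].

(* [K] vertices with one further point in each gap; the number of such pairs is
   the sum over polygons [x] of the product of the sizes of the gaps of [x]. *)
Definition gap_choices (z : {ffun 'I_K -> T} * {ffun 'I_K -> T}) :=
  [&& polygonal z.1, z.2 \in family (gap_set z.1)
    & #|vertices z.1 z.2| == K + K].

Lemma polygon_gap_choice (A : {set T}) : 1 < K -> (2 ^ (4 * K)).+1 < #|A| ->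
  exists2 z, gap_choices z & vertices z.1 z.2 \subset A.
Proof.
move=> K1 Abig.
have [|W [WA W3 sW]] := @polygon_in A (K + K).
  by rewrite (_ : _ + _ = 4 * K) //; lia.
have [a aA] : exists a, a \in A by apply/card_gt0P; lia.
(* Of a polygon with [K + K] vertices, those at even places form [x] and those at odd places fill
   its gaps. *)
pose x := [ffun i : 'I_K => nth a W (2 * i)].
pose y := [ffun i : 'I_K => nth a W (2 * i).+1].
have W3' := elimT (triwiseP ccw a W) W3; rewrite sW in W3'.
have vW : vertices x y = [set u in W].
  apply/setP => u; rewrite !inE; apply/orP/idP.
    case=> /imsetP[i _ ->]; rewrite ffunE mem_nth // sW; have := ltn_ord i; lia.
  case/(nthP a) => n; rewrite sW => nK <-.
  have n2 : n./2 < K by lia.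
  case: (boolP (odd n)) => on; [right|left]; apply/imsetP;
    exists (Ordinal n2); rewrite // ffunE /=; congr nth; lia.
exists (x, y) => /=; last first.
  by rewrite vW; apply/subsetP => u; rewrite inE => /WA.
apply/and3P; split=> /=.
- apply/'forall_'forall_forallP => i j k; apply/implyP => /andP[ij jk].
  by rewrite !ffunE; apply: W3'; have := ltn_ord k; lia.
- apply/familyP => i; rewrite inE; apply/'forall_forallP => j k.
  have iK := ltn_ord i; have jK := ltn_ord j; have kK := ltn_ord k.
  by apply/and3P; split; apply/implyP => /andP[h1 h2];
    rewrite !ffunE; apply: W3'; lia.
- rewrite vW cardsE; apply/eqP; rewrite -[RHS]sW; apply/card_uniqP.
  by apply: (triwise_uniq (ccw_neq cc)) W3; rewrite sW; lia.
Qed.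

(** Double counting: every [m]-subset contains a gap choice, while a choice, having exactly [K + K]
    vertices, lies in at most a fraction [(m / #|T|) ^ (K + K)] of the [m]-subsets. *)
Lemma many_gap_choices m : 1 < K -> (2 ^ (4 * K)).+1 < m -> m <= #|T| ->
  #|T| ^ (K + K) <= m ^ (K + K) * #|[set z | gap_choices z]|.
Proof.
move=> K1 Km mN; set N := #|T| in mN *; set G := [set z | gap_choices z].
have KKm : K + K <= m.
  apply: ltnW; apply: leq_trans Km; apply: leqW; apply: leqW.
  by apply: leq_trans (ltnW (ltn_expl _ _)) => //; lia.
have c0 : 0 < 'C(N - (K + K), m - (K + K)) by rewrite bin_gt0; lia.
rewrite -(leq_pmul2r c0); apply: leq_trans (expn_bin_leq KKm mN) _.
rewrite -mulnA leq_mul2l; apply/orP; right.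
have -> : 'C(N, m) = #|[set A : {set T} | #|A| == m]|.
  by rewrite -card_draws.
rewrite -sum_nat_const -sum1_card.
apply: (@leq_trans (\sum_(z in G)
  #|[set A : {set T} | vertices z.1 z.2 \subset A & #|A| == m]|)); last first.
  apply: leq_sum => z; rewrite inE => /and3P[_ _ /eqP vz].
  by rewrite -vz; exact: card_supersets.
under [leqRHS]eq_bigr do rewrite -sum1_card.
rewrite (exchange_big_dep (mem [set A : {set T} | #|A| == m])) /=; last first.
  by move=> z A _; rewrite !inE => /andP[].
apply: leq_sum => A; rewrite inE => /eqP Am.
have [|z zG zA] := polygon_gap_choice K1 (A := A); first by rewrite Am.
by rewrite (bigD1 z) //= !inE zG zA Am eqxx.
Qed.

(** Pigeonhole over the [#|T| ^ K] functions [x]: if all products were too small, there would be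
    fewer gap choices than [many_gap_choices] provides. *)
Lemma large_gap_product m : 1 < K -> (2 ^ (4 * K)).+1 < m -> m <= #|T| ->
  exists2 x, polygonal x &
    #|T| ^ K <= m ^ (K + K) * \prod_(i < K) #|gap_set x i|.
Proof.
move=> K1 Km mN; apply: contrapT => no.
have N0 : 0 < #|T| by lia.
have NK0 : 0 < #|T| ^ K by rewrite expn_gt0 N0.
have := many_gap_choices K1 Km mN; rewrite leqNgt => /negP; apply.
apply: (@leq_ltn_trans (\sum_(x : {ffun 'I_K -> T}) (#|T| ^ K).-1)); last first.
  rewrite sum_nat_const card_ffun card_ord expnD ltn_mul2l NK0 /=.
  by rewrite prednK.
rewrite -sum1_card big_distrr /=.
rewrite (eq_bigl gap_choices); last by move=> z; rewrite inE.
rewrite (eq_bigr (fun z => m ^ (K + K))); last by move=> z _; rewrite muln1.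
(* Forgetting that the vertices are distinct leaves a full product of gap sets for each [x]. *)
apply: (@leq_trans (\sum_(x : {ffun 'I_K -> T} | polygonal x)
                   \sum_(y in family (gap_set x)) m ^ (K + K))).
  rewrite pair_big_dep /= [leqLHS]big_mkcond [leqRHS]big_mkcond /=.
  by apply: leq_sum => z _; rewrite /gap_choices; do !case: ifP => // /and3P[-> ->].
rewrite big_mkcond; apply: leq_sum => x _; case: ifP => // px.
rewrite sum_nat_const card_family /=.
rewrite -ltnS prednK // ltnNge; apply/negP => le; apply: no; exists x => //.
move: le; rewrite mulnC foldrE big_map big_enum; exact.
Qed.
End Count.

(** Among [2 * g] gaps, a large product of sizes leaves at most [g] below [M]; the vertices that
    open the other gaps form the polygon. *)
Lemma positive_fraction g M : 0 < g -> 0 < M -> 2 ^ (32 * g) * M <= #|T| ->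
  exists X P, gapped ccw g X P /\ forall i, i < g -> M <= #|P i|.
Proof.
move=> g0 M0 NM; set K := 2 * g.
have K1 : 1 < K by rewrite /K; lia.
have M32 : 2 ^ (32 * g) <= #|T| by apply: leq_trans NM; rewrite leq_pmulr.
pose m := 2 ^ (8 * g).+1.
have Km : (2 ^ (4 * K)).+1 < m.
  have -> : 4 * K = 8 * g by rewrite /K mulnA.
  rewrite /m expnS; have := @ltn_expl 2 (8 * g) isT.
  by move: (2 ^ (8 * g)) => e; lia.
have mN : m <= #|T| by apply: leq_trans M32; rewrite leq_pexp2l //; lia.
have [x px xN] := large_gap_product K1 Km mN.
pose bad := [pred i : 'I_K | #|gap_set x i| < M].
have badg : #|bad| <= g.
  have T0 : 0 < #|T| by lia.
  have prod0 : 0 < \prod_(i < K) #|gap_set x i|.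
    have : 0 < #|T| ^ K by rewrite expn_gt0 T0.
    by move: xN; case: (\prod_(i < K) _) => //; rewrite muln0; case: (#|T| ^ K).
  have : 2 ^ (32 * g * #|bad|) * \prod_(i < K) #|gap_set x i| <= #|T| ^ K.
    have -> : 2 ^ (32 * g * #|bad|) =
              \prod_(i < K) (if bad i then 2 ^ (32 * g) else 1).
      by rewrite expnM -big_mkcond prod_nat_const.
    have -> : #|T| ^ K = \prod_(i < K) #|T| by rewrite prod_nat_const card_ord.
    rewrite -big_split /=.
    apply: leq_prod => i _; case: ifP => [bi|_]; last by rewrite mul1n max_card.
    by apply: leq_trans NM; rewrite leq_mul2l (ltnW bi) orbT.
  (* The total loss is [m ^ (4 * g)], that is [2 ^ (32 * g ^ 2 + 4 * g)], and each bad gap costs a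
     factor [2 ^ (32 * g)]; so [g + 1] bad gaps are too many. *)
  move=> /leq_trans/(_ xN); rewrite leq_pmul2r // /m -expnM leq_exp2l //.
  rewrite /K; nia.
pose G := [seq i <- enum 'I_K | ~~ bad i].
have Gg : g <= size G.
  have cb : count bad (enum 'I_K) = #|bad|.
    by rewrite -sum1_count big_enum_cond -sum1_card; apply: eq_bigl.
  have cG : size G = count (predC bad) (enum 'I_K) by rewrite size_filter.
  have := count_predC bad (enum 'I_K).
  rewrite cG size_enum_ord cb; move: badg; rewrite /K.
  move: #|_| (count _ _) => c d; lia.
have i0 : 'I_K by exists 0; lia.
have Glt j k : j < k -> k < size G -> nth i0 G j < nth i0 G k.
  move=> jk kG; pose r := [rel i j : 'I_K | i < j].
  have r_trans : transitive r by move=> b a c; exact: ltn_trans.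
  have rG : sorted r G.
    apply: sorted_filter => //.
    by have := iota_ltn_sorted 0 K; rewrite -val_enum_ord sorted_map.
  by apply: (sorted_ltn_nth r_trans i0 rG) => //; rewrite inE; lia.
have Gle j k : j <= k -> k < size G -> nth i0 G j <= nth i0 G k.
  by rewrite leq_eqVlt => /predU1P[-> //|jk kG]; exact/ltnW/Glt.
have gG k : k < g -> k < size G by move=> kg; exact: leq_trans kg Gg.
(* [gap_set] compares its points with all pairs of vertices of [x], so its conditions survive the
   removal of vertices. *)
exists (fun i => x (nth i0 G i)), (fun i => gap_set x (nth i0 G i)).
split; last first.
  move=> i /gG iG; have : nth i0 G i \in G by rewrite mem_nth.
  by rewrite mem_filter /= -leqNgt => /andP[].
have gapP i p : p \in gap_set x i -> forall j k : 'I_K,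
  [/\ j < k -> k <= i -> ccw (x j) (x k) p, j <= i -> i < k -> ccw (x j) p (x k)
    & i < j -> j < k -> ccw p (x j) (x k)].
  rewrite inE => /'forall_forallP h j k; have /and3P[h1 h2 h3] := h j k.
  split=> ij jk; [move: h1|move: h2|move: h3]; rewrite ij jk; exact.
split.
- move=> i j k ij jk kg; have jg := ltn_trans jk kg.
  move/'forall_'forall_forallP: px => /(_ (nth i0 G i)).
  by move=> /(_ (nth i0 G j) (nth i0 G k)); rewrite !Glt ?gG.
- move=> i j k p /gapP/(_ (nth i0 G j) (nth i0 G k))[h _ _] jk ki ig.
  have kg := leq_ltn_trans ki ig.
  by apply: h; [apply: Glt|apply: Gle]; rewrite ?gG.
- move=> i j k p /gapP/(_ (nth i0 G j) (nth i0 G k))[_ h _] ji ik kg.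
  have ig := ltn_trans ik kg.
  by apply: h; [apply: Gle|apply: Glt]; rewrite ?gG.
- move=> i j k p /gapP/(_ (nth i0 G j) (nth i0 G k))[_ _ h] ij jk kg.
  have jg := ltn_trans jk kg.
  by apply: h; apply: Glt; rewrite ?gG.
Qed.

Theorem polygon_of_card s n u : 0 < s -> n <= s * u ->
  2 ^ (32 * (s * s.+1 + 2)) * (2 ^ (n + u) * (u + n) ^ u).+1 <= #|T| ->
  exists2 W, triwise ccw W & n <= size W.
Proof.
move=> s0 nsu big.
have g0 : 0 < s * s.+1 + 2 by lia.
have [X [P [gP PM]]] := positive_fraction g0 (ltn0Sn _) big.
by apply: (gapped_polygon cc gP s0 nsu) PM; lia.
Qed.

End PositiveFraction.

Import Order.TTheory GRing.Theory Num.Theory.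

(** * Orientations in the plane *)

Section Plane.
Local Open Scope ring_scope.
Variable R : realType.
Implicit Types p q r t s : 'rV[R]_2.

(** Twice the signed area of the triangle, positive for a counterclockwise turn. *)
Definition det p q r :=
  (q 0 0 - p 0 0) * (r 0 1 - p 0 1) - (q 0 1 - p 0 1) * (r 0 0 - p 0 0).

Lemma det_rot p q r : det p q r = det q r p.
Proof. by rewrite /det; ring. Qed.

Lemma det_swap p q r : det p r q = - det p q r.
Proof. by rewrite /det; ring. Qed.

Lemma detpp p q : det p q p = 0.
Proof. by rewrite /det; ring. Qed.

Lemma detqq p q : det p q q = 0.
Proof. by rewrite /det; ring. Qed.

Lemma det_interior p q r t : det p q r = det t q r + det p t r + det p q t.
Proof. by rewrite /det; ring. Qed.

(** The three-term Grassmann-Plücker relation, from which the five-point axioms follow by signs. *)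
Lemma det_plucker t s p q r :
  det t s q * det t p r = det t s p * det t q r + det t s r * det t p q.
Proof. by rewrite /det; ring. Qed.

Lemma ord2_max : ord_max = 1 :> 'I_2.
Proof. exact/val_inj. Qed.

Lemma rV2_eq p q : p 0 0 = q 0 0 -> p 0 1 = q 0 1 -> p = q.
Proof.
move=> e0 e1; apply/rowP => -[[|[|//]] lt_i].
- by rewrite (_ : Ordinal lt_i = 0) //; exact/val_inj.
- by rewrite (_ : Ordinal lt_i = 1) //; exact/val_inj.
Qed.

Lemma det_neq0 (P : {fset 'rV[R]_2}) p q r : general_position P ->
  p \in P -> q \in P -> r \in P -> p != q -> q != r -> p != r ->
  det p q r != 0.
Proof.
move=> gP pP qP rP /eqP pq /eqP qr /eqP pr; apply/eqP => d0.
apply: (gP p q r) => //.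
pose a := p 0 1 - q 0 1; pose b := q 0 0 - p 0 0.
pose c := a * p 0 0 + b * p 0 1.
exists [set z | a * z ord0 ord0 + b * z ord0 ord_max = c]%classic; split.
- exists a, b, c; split=> //.
  case=> /eqP; rewrite subr_eq0 => /eqP e1 /eqP; rewrite subr_eq0 => /eqP e0.
  by apply: pq; exact: rV2_eq.
- by rewrite /= ord2_max.
- by rewrite /= ord2_max /c /a /b; ring.
- rewrite /= ord2_max; apply/eqP; rewrite -subr_eq0 -d0 /det /c /a /b.
  by apply/eqP; ring.
Qed.

Definition lexlt : rel 'rV[R]_2 :=
  fun p q => (p 0 0 < q 0 0) || (p 0 0 == q 0 0) && (p 0 1 < q 0 1).

Lemma lexlt_irr p : ~~ lexlt p p.
Proof. by rewrite /lexlt !ltxx andbF. Qed.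

Lemma lexlt_trans q p r : lexlt p q -> lexlt q r -> lexlt p r.
Proof.
rewrite /lexlt => /orP[h1|/andP[/eqP-> h1]] /orP[h2|/andP[/eqP<- h2]].
- by rewrite (lt_trans h1 h2).
- by rewrite h1.
- by rewrite h2.
- by rewrite eqxx (lt_trans h1 h2) orbT.
Qed.

(* Around a lexicographically minimal point all others lie in a half-plane. *)
Lemma det_lex_trans a p q r :
  ~~ lexlt p a -> ~~ lexlt q a -> ~~ lexlt r a ->
  det a p q > 0 -> det a q r > 0 -> det a p r >= 0.
Proof.
have half z : ~~ lexlt z a ->
    z 0 0 - a 0 0 > 0 \/ z 0 0 - a 0 0 = 0 /\ z 0 1 - a 0 1 >= 0.
  rewrite /lexlt negb_or negb_and -!leNgt => /andP[].
  rewrite le_eqVlt => /predU1P[-> |h _]; last by left; rewrite subr_gt0.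
  by rewrite eqxx /= => h; right; rewrite subrr subr_ge0.
rewrite /det => /half hp /half hq /half hr.
move: (p 0 0 - _) (p 0 1 - _) hp (q 0 0 - _) (q 0 1 - _) hq
      (r 0 0 - _) (r 0 1 - _) hr => u1 u2 hu v1 v2 hv w1 w2 hw uv vw.
have u1_ge0 : 0 <= u1 by case: hu => [/ltW//|[-> _]].
have w1_ge0 : 0 <= w1 by case: hw => [/ltW//|[-> _]].
(* On the vertical line through [a], [q] would be last in the angular order and [r] could not follow
   it. *)
case: hv => [v1_gt0|[v10 v2_ge0]]; last first.
  by move: vw; rewrite v10 mul0r sub0r oppr_gt0 ltNge mulr_ge0.
rewrite -(pmulr_rge0 _ v1_gt0).
have -> : v1 * (u1 * w2 - u2 * w1) =
  w1 * (u1 * v2 - u2 * v1) + u1 * (v1 * w2 - v2 * w1) by ring.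
by rewrite addr_ge0 // mulr_ge0 // ltW.
Qed.

Lemma orientation_plane (P : {fset 'rV[R]_2}) : general_position P ->
  orientation (fun p q r : P => 0 < det (val p) (val q) (val r)).
Proof.
move=> gP.
have neq0 (p q r : P) : p != q -> q != r -> p != r ->
    det (val p) (val q) (val r) != 0.
  by move=> pq qr pr; apply: det_neq0 gP _ _ _ _ _ _ => //; exact: valP.
split.
- by move=> p q r; rewrite det_rot.
- by move=> p q r h; rewrite det_swap oppr_gt0 -leNgt ltW.
- move=> p q r /and3P[pq qr pr]; rewrite (det_swap _ (val q)) oppr_gt0 orbC.
  by rewrite -neq_lt neq0.
- by move=> p q r t h1 h2 h3; rewrite (det_interior _ _ _ (val t)) addr_gt0 // addr_gt0.
- move=> t s p q r h1 h2 h3 h4 h5; rewrite -(pmulr_rgt0 _ h2) det_plucker.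
  by rewrite addr_gt0 // mulr_gt0.
- move=> t s p q r h1 h2 h3 h4 h5; rewrite -(pmulr_rgt0 _ h2).
  have -> : det (val t) (val q) (val s) * det (val t) (val p) (val r) =
      det (val t) (val p) (val s) * det (val t) (val q) (val r) +
      det (val t) (val r) (val s) * det (val t) (val p) (val q).
    by rewrite /det; ring.
  by rewrite addr_gt0 // mulr_gt0.
- move=> t s p q r h1 h2 h3 h4 h5; rewrite -(pmulr_lgt0 _ h5).
  have -> : det (val t) (val q) (val s) * det (val t) (val r) (val p) =
      det (val t) (val s) (val p) * det (val t) (val q) (val r) +
      det (val t) (val s) (val r) * det (val t) (val p) (val q).
    by rewrite /det; ring.
  by rewrite addr_gt0 // mulr_gt0.
- move=> t s p q r h1 h2 h3 h4 h5; rewrite -(pmulr_lgt0 _ h5).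
  have -> : det (val t) (val s) (val q) * det (val t) (val r) (val p) =
      det (val t) (val p) (val s) * det (val t) (val q) (val r) +
      det (val t) (val r) (val s) * det (val t) (val p) (val q).
    by rewrite /det; ring.
  by rewrite addr_gt0 // mulr_gt0.
- move=> A A0.
  have [a aA amin] := @exists_minimal _ (fun p q : P => lexlt (val p) (val q)) A
    (fun p : P => lexlt_irr _)
    (fun (q p r : P) _ _ _ => @lexlt_trans _ _ _) A0.
  exists a => // p q r pA qA rA pr h1 h2; rewrite lt_neqAle eq_sym.
  apply/andP; split; last by apply: det_lex_trans h1 h2; exact: amin.
  apply: neq0 => //.
  + by apply: contraTneq h1 => ->; rewrite det_rot detpp ltxx.
  + by apply: contraTneq h2 => ->; rewrite detpp ltxx.
Qed.

(** * From counterclockwise lists to convex position *)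

(** The open half-plane to the left of the line from [p] to [q], with [q] adjoined, is convex,
    because [det p q] is affine in its last argument. *)
Lemma det_segment p q x y (l : R) : 0 < l -> l < 1 ->
  0 < det p q x \/ x = q -> 0 < det p q y \/ y = q ->
  0 < det p q (l *: x + (1 - l) *: y) \/ l *: x + (1 - l) *: y = q.
Proof.
move=> l0 l1; have l1' : 0 < 1 - l by rewrite subr_gt0.
have -> : det p q (l *: x + (1 - l) *: y) = l * det p q x + (1 - l) * det p q y.
  by rewrite /det !mxE; ring.
move=> [hx|->] [hy|->]; rewrite ?detqq ?mulr0 ?addr0 ?add0r.
- by left; rewrite addr_gt0 // mulr_gt0.
- by left; rewrite mulr_gt0.
- by left; rewrite mulr_gt0.
- by right; rewrite -scalerDl addrC subrK scale1r.
Qed.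

(** The half-plane of [det_segment] contains [A] and misses [p]; a closed one would contain [p]. *)
Lemma hull_avoids (A : set 'rV[R]_2) p q : p != q ->
  (forall r, A r -> r != q -> 0 < det p q r) -> ~ Defs.convex_hull A p.
Proof.
move=> pq Apos; pose H := [set z | 0 < det p q z \/ z = q]%classic.
have Hconvex : @convex_set R 'rV[R]_2 H.
  apply/convex_setW => x y /set_mem xH /set_mem yH k k0 k1.
  exact/mem_set/(det_segment k0 k1 xH yH).
have AH : (A `<=` H)%classic.
  by move=> r Ar; have [->|rq] := eqVneq r q; [right|left; exact: Apos].
move=> /(smallest_sub Hconvex AH) []; first by rewrite detpp ltxx.
by move/eqP: pq => pq /pq.
Qed.

Lemma polygon_successor (S : seq 'rV[R]_2) : (1 < size S)%N -> uniq S ->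
  triwise (fun p q r => 0 < det p q r) S -> forall p, p \in S ->
  exists2 q, p != q &
    forall r, r \in S -> r != p -> r != q -> 0 < det p q r.
Proof.
move=> S1 S_uniq S3 p pS; have W := elimT (triwiseP _ p S) S3.
have iS : (index p S < size S)%N by rewrite index_mem.
have pE k : (k < size S)%N -> (p == nth p S k) = (index p S == k).
  by move=> kS; rewrite -{1}(nth_index p pS) nth_uniq.
have [iS1|] := ltnP (index p S).+1 (size S).
  exists (nth p S (index p S).+1); first by rewrite pE // ltn_eqF.
  move=> r rS rp rq; have rlt : (index r S < size S)%N by rewrite index_mem.
  rewrite -{1}(nth_index p pS) -(nth_index p rS).
  have [ri|ir] := ltnP (index r S) (index p S).
    by rewrite det_rot det_rot; apply: W.
  apply: W => //; rewrite ltn_neqAle; apply/andP; split.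
    by apply: contra_neq rq => e; rewrite -(nth_index p rS) e.
  rewrite ltn_neqAle ir andbT; apply: contra_neq rp => e.
  by rewrite -(nth_index p rS) -e nth_index.
(* The successor of the last vertex is the first one. *)
move=> lastp; exists (nth p S 0); first by rewrite pE; lia.
move=> r rS rp rq; have rlt : (index r S < size S)%N by rewrite index_mem.
rewrite -{1}(nth_index p pS) -(nth_index p rS) det_rot.
apply: W => //.
  by rewrite lt0n; apply: contra_neq rq => e; rewrite -(nth_index p rS) e.
rewrite ltn_neqAle; apply/andP; split; last lia.
by apply: contra_neq rp => e; rewrite -(nth_index p rS) e nth_index.
Qed.

Lemma forces_of_polygon (P : {fset 'rV[R]_2}) n (W : seq P) :
  general_position P -> (2 < n)%N ->
  triwise (fun p q r : P => 0 < det (val p) (val q) (val r)) W ->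
  (n <= size W)%N -> contains_convex n P.
Proof.
move=> gP n2 W3 sW; pose S := map val (take n W).
have sS : size S = n by rewrite size_map size_takel.
have S3 : triwise (fun p q r => 0 < det p q r) S.
  have := triwise_subseq (take_subseq W n) W3; rewrite /S.
  elim: (take n W) => //= p s IH /andP[h1 /IH ->]; rewrite andbT.
  by rewrite pairwise_map.
have SP p : p \in S -> p \in P by case/mapP => q _ ->; exact: valP.
have S_uniq : uniq S.
  rewrite map_inj_uniq; last exact: val_inj.
  apply: (triwise_uniq (ccw_neq (orientation_plane gP))).
    by rewrite size_takel.
  exact: triwise_subseq (take_subseq W n) W3.
exists [fset p in S]%fset; split.
- by apply/fsubsetP => p; rewrite finmap.inE => /SP.
- by rewrite card_fseq undup_id.
split=> [p q r|p]; rewrite !finmap.inE.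
  by move=> /SP pP /SP qP /SP rP; exact: gP.
move=> pS; have S1 : (1 < size S)%N by rewrite sS; lia.
have [q pq qpos] := polygon_successor S1 S_uniq S3 pS.
apply: (hull_avoids pq) => r /=; rewrite !finmap.inE => /andP[rp rS] rq.
exact: qpos.
Qed.
End Plane.

(** * The numerical bound on ES(n) *)

(** [q] bounds the binary logarithm of [u + n]; the final [1] in the exponent pays for the successor
    in [polygon_of_card]. *)
Lemma forces_convex_pow2 (R : realType) s n u q E : (0 < s)%N -> (2 < n)%N ->
  (n <= s * u)%N -> (u + n <= 2 ^ q)%N ->
  (32 * (s * s.+1 + 2) + (n + u) + q * u + 1 <= E)%N ->
  forces_convex R n (2 ^ E).
Proof.
move=> s0 n2 nsu unq leE P gP cardP.
have [|W W3 nW] := polygon_of_card (orientation_plane gP) s0 nsu; last first.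
  exact: forces_of_polygon gP n2 W3 nW.
rewrite -cardfE cardP; apply: (@leq_trans (2 ^ (32 * (s * s.+1 + 2)) *
    2 ^ (n + u + q * u).+1)); last first.
  by rewrite -expnD leq_pexp2l //; lia.
rewrite leq_mul2l; apply/orP; right.
rewrite expnS mul2n -addnn -addn1; apply: leq_add; last by rewrite expn_gt0.
rewrite (expnD _ (n + u)) leq_mul2l expnM leq_exp2r ?unq ?orbT //.
by case: u nsu {unq leE} => //; rewrite muln0; lia.
Qed.

Lemma is_ES_exists (R : realType) n M : forces_convex R n M ->
  exists2 N, is_ES R n N & (N <= M)%N.
Proof.
move=> fM; have ex : exists N, `[< forces_convex R n N >] by exists M; exact/asboolP.
case: (ex_minnP ex) => N /asboolP fN Nmin; exists N; last exact/Nmin/asboolP.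
by split=> // K fK; exact/Nmin/asboolP.
Qed.

Local Open Scope ring_scope.

(** Since [y] and [1] are at most [y ^+ 2], the left side exceeds [n] by at most
    [(263 + 2 * L) * y ^+ 2], and [263 <= 4 * L] as soon as [66 <= L]. *)
Lemma exponent_bound (R : realType) (n s u l : nat) (y L : R) :
  1 <= y -> s%:R <= y + 1 -> u%:R <= y ^+ 2 + 1 -> l%:R <= L -> 66 <= L ->
  (32 * (s * s.+1 + 2) + (n + u) + l.+2 * u + 1)%N%:R <= n%:R + 6 * y ^+ 2 * L.
Proof.
move=> y1 sy uy lL L66.
rewrite !(natrD, natrM) -(@natr1 _ s) -(@natr1 _ l.+1)
  -(@natr1 _ l).
have s_ge0 : 0 <= s%:R :> R by exact: ler0n.
have u_ge0 : 0 <= u%:R :> R by exact: ler0n.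
have l_ge0 : 0 <= l%:R :> R by exact: ler0n.
have y2 : y <= y ^+ 2 by nra.
have hs : s%:R * (s%:R + 1) <= (y + 1) * (y + 2).
  by apply: ler_pM => //; lra.
have hu : (l%:R + 1 + 1) * u%:R <= (L + 2) * (y ^+ 2 + 1).
  by apply: ler_pM => //; lra.
nra.
Qed.

Theorem theorem1p1 (R : realType) :
  exists n0 : nat, forall n : nat, (n0 <= n)%N ->
    exists N : nat, is_ES R n N /\
      N%:R <= (2 : R) `^ (n%:R + 6 * n%:R `^ (2 / 3) * log2 n%:R).
Proof.
(* keeps [2 ^ 66] from being computed *)
have [k k66] : exists k, k = 66%N by exists 66%N.
(* This threshold makes the binary logarithm of [n] at least 66, as [exponent_bound] asks. *)
exists (2 ^ k)%N => n nk.
have n3 : (2 < n)%N.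
  by apply: leq_trans nk; rewrite (leq_trans _ (ltn_expl k _)) // k66.
have n_gt0 : (0 < n)%N by lia.
have n_gt0R : 0 < n%:R :> R by rewrite ltr0n.
pose y : R := n%:R `^ (1 / 3).
have y2E : n%:R `^ (2 / 3) = y ^+ 2.
  by rewrite -powR_mulrn ?powR_ge0 // -powRrM; congr powR; field.
have y3E : y ^+ 3 = n%:R.
  rewrite -powR_mulrn ?powR_ge0 // -powRrM divfK ?pnatr_eq0 //.
  by rewrite powRr1 // ltW.
have y1 : 1 <= y.
  by rewrite -(@powRr0 _ n%:R) ler_powR ?ler1n // divr_ge0.
(* As [s] exceeds [y], the quotient [n %/ s] is at most [n / y], which is [y ^+ 2]; the successor in
   [u] secures [n <= s * u]. *)
pose s := (Num.truncn y).+1; pose u := (n %/ s).+1.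
have /andP[sy ys] := truncn_itv (le_trans ler01 y1).
have s2 : (1 < s)%N by rewrite ltnS truncn_gt0.
have nsu : (n <= s * u)%N by rewrite mulnC ltnW // ltn_ceil //; lia.
have uy : u%:R <= y ^+ 2 + 1.
  rewrite -natr1 lerD2r -(ler_pM2r (lt_le_trans ltr01 y1)) -exprSr y3E.
  apply: (@le_trans _ _ ((n %/ s)%:R * s%:R)); first by rewrite ler_wpM2l ?ler0n // ltW.
  by rewrite -natrM ler_nat leq_trunc_div.
have un : (u <= n)%N by exact: ltn_Pdiv.
(* Rounding down keeps [l] below the real logarithm; [l.+2] is then enough for [u + n], which is at
   most [2 * n]. *)
pose l := trunc_log 2 n.
have lk : (66 <= l)%N by rewrite -k66; apply: trunc_log_max.
have lL : l%:R <= log2 n%:R :> R.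
  rewrite /log2 ler_pdivlMr ?ln_gt0 ?ltr1n // mulrC mulr_natr -lnXn ?ltr0n //.
  by rewrite ler_ln ?posrE ?exprn_gt0 ?ltr0n // -natrX ler_nat trunc_logP.
have unq : (u + n <= 2 ^ l.+2)%N.
  by have := @trunc_log_ltn 2 n isT; rewrite -/l (expnS _ l.+1); lia.
have [N NES NM] := is_ES_exists
  (forces_convex_pow2 (R := R) (ltnW s2) n3 nsu unq (leqnn _)).
exists N; split=> //; set E := (_ + 1)%N in NM.
apply: (@le_trans _ _ (2 ^ E)%:R); first by rewrite ler_nat.
rewrite natrX -powR_mulrn // ler_powR ?ler1n // y2E.
have sy1 : s%:R <= y + 1 by rewrite -natr1 lerD2r.
rewrite /E; apply: (exponent_bound n y1 sy1 uy lL); apply: le_trans lL.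
by rewrite ler_nat.
Qed.
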